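(* There exist fibers on which functional dimension is not constant; that is, there exist an architecture $(n_0,\ldots,n_m)$, a function $f\in\mathcal{M}_{n_0,\ldots,n_m}$, and two ordinary parameters $\theta_1,\theta_2\in\rho^{-1}(f)$ with $\dim_{\mathrm{fun}}(\theta_1)\neq\dim_{\mathrm{fun}}(\theta_2)$.
   Context: An architecture is a tuple $(n_0,\ldots,n_m)$ of positive integers with $m\ge 1$. Let $\sigma$ denote the map applying $t\mapsto\max\{0,t\}$ to each coordinate of a vector in any $\mathbb{R}^n$. Put $D(n_0,\ldots,n_m)=\sum_{i=1}^m n_i(n_{i-1}+1)$ and $\mathcal{P}_{n_0,\ldots,n_m}=\mathbb{R}^{D(n_0,\ldots,n_m)}$ (parameter space). A parameter $\theta\in\mathcal{P}_{n_0,\ldots,n_m}$ is identified with a list of matrices $[A^i]$ of size $n_i\times(n_{i-1}+1)$, $1\le i\le m$, giving affine maps $A^i:\mathbb{R}^{n_{i-1}}\to\mathbb{R}^{n_i}$, $A^i(x)=[A^i][x,1]^T$. The realization map $\rho:\mathcal{P}_{n_0,\ldots,n_m}\to C(\mathbb{R}^{n_0},\mathbb{R}^{n_m})$ sends $\theta$ to the function $\rho(\theta)=\sigma\circ A^m\circ\cdots\circ\sigma\circ A^1$. The moduli space $\mathcal{M}_{n_0,\ldots,n_m}$ is the image of $\rho$, and for $f\in\mathcal{M}_{n_0,\ldots,n_m}$ the fiber of $f$ is $\rho^{-1}(f)$. Let $\mathcal{F}(\theta,x)=\rho(\theta)(x)$. A point $x\in\mathbb{R}^{n_0}$ is parametrically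 smooth for $\theta$ if $\mathcal{F}:\mathcal{P}_{n_0,\ldots,n_m}\times\mathbb{R}^{n_0}\to\mathbb{R}^{n_m}$ is $C^\infty$ at $(\theta,x)$ (i.e. on a neighborhood of it). A finite set $Z\subset\mathbb{R}^{n_0}$ is parametrically smooth for $\theta$ if all its points are. A parameter $\theta$ is ordinary if at least one point of $\mathbb{R}^{n_0}$ is parametrically smooth for $\theta$. For a finite ordered set $Z=\{z_1,\ldots,z_k\}\subset\mathbb{R}^{n_0}$, the evaluation map $E_Z:\mathcal{P}_{n_0,\ldots,n_m}\to\mathbb{R}^{k n_m}$ is $E_Z(\theta)=(\rho(\theta)(z_1),\ldots,\rho(\theta)(z_k))$, and $\mathbf{J}E_Z|_\theta$ is its Jacobian matrix with respect to the parameter coordinates at $\theta$. The functional dimension of an ordinary parameter $\theta$ is $$\dim_{\mathrm{fun}}(\theta)=\sup\{\operatorname{rank}\mathbf{J}E_Z|_\theta : Z\subset\mathbb{R}^{n_0}\text{ finite and parametrically smooth for }\theta\}.$$ *)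

(* Defs.v *)
From HB Require Import structures.
From mathcomp Require Import all_boot all_order all_algebra.
From mathcomp Require Import all_classical all_reals all_analysis.

Set Implicit Arguments.
Unset Strict Implicit.
Unset Printing Implicit Defensive.

Import Order.TTheory GRing.Theory Num.Theory.
Import numFieldNormedType.Exports.

Local Open Scope classical_set_scope.
Local Open Scope ring_scope.

(* An architecture (n_0, n_1, ..., n_m) is given by its head n0 and its tail
   ns = [:: n_1; ...; n_m]; thus m = size ns and n_m = last n0 ns. *)
Definition is_architecture (n0 : nat) (ns : seq nat) : bool :=
  all (leq 1) (n0 :: ns) && (0 < size ns)%N.

(* D(n_0, ..., n_m) = \sum_(1 <= i <= m) n_i * (n_(i-1) + 1) *)
Definition nparams (n0 : nat) (ns : seq nat) : nat :=
  sumn (pairmap (fun a b => b * (a + 1))%N n0 ns).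

(* Iterated Frechet derivatives: in finite dimension, a function is of class
   C^(k+1) on the open set U iff it is differentiable on U and x |-> df_x(v)
   is of class C^k on U for every direction v. *)
Fixpoint Ck_on (R : realType) (V W : normedModType R) (k : nat) (U : set V)
    (f : V -> W) : Prop :=
  match k with
  | 0 => forall x, U x -> {for x, continuous f}
  | k'.+1 => (forall x, U x -> differentiable f x) /\
             (forall v : V, Ck_on k' U (fun x => 'd f x v))
  end.

Definition smooth_at (R : realType) (V W : normedModType R) (f : V -> W)
    (p : V) : Prop :=
  exists U : set V, [/\ open U, U p & forall k, Ck_on k U f].

Section ReLUNetworks.
Variable R : realType.

Definition relu n (x : 'rV[R]_n) : 'rV[R]_n := map_mx (fun t => Num.max 0 t) x.

(* Points of R^n are row vectors, hence the transpositions. *)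
Definition affine_map n m (A : 'M[R]_(m, n + 1)) (x : 'rV[R]_n) : 'rV[R]_m :=
  (A *m (row_mx x (const_mx 1))^T)^T.

(* The first n1 * (n0 + 1) coordinates of theta are the entries of [A^1] in
   row-major order; the remaining ones parametrize the next layers. *)
Fixpoint realization (n0 : nat) (ns : seq nat) :
    'rV[R]_(nparams n0 ns) -> 'rV[R]_n0 -> 'rV[R]_(last n0 ns) :=
  match ns with
  | [::] => fun _ x => x
  | n1 :: ns' => fun theta x =>
      let A : 'M[R]_(n1, n0 + 1) :=
        vec_mx (@lsubmx R 1 (n1 * (n0 + 1)) (nparams n1 ns') theta) in
      realization (@rsubmx R 1 (n1 * (n0 + 1)) (nparams n1 ns') theta)
                  (relu (affine_map A x))
  end.

Section Architecture.
Variables (n0 : nat) (ns : seq nat).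
Local Notation P := 'rV[R]_(nparams n0 ns).
Local Notation X := 'rV[R]_n0.
Local Notation Y := 'rV[R]_(last n0 ns).

Definition moduli_space : set (X -> Y) := range (@realization n0 ns).

Definition fiber (f : X -> Y) : set P := @realization n0 ns @^-1` [set f].

Definition param_smooth (theta : P) (x : X) : Prop :=
  smooth_at (fun q : P * X => realization q.1 q.2) (theta, x).

Definition ordinary (theta : P) : Prop := exists x : X, param_smooth theta x.

Definition evaluation (Z : seq X) (theta : P) :
    'rV[R]_(size Z * last n0 ns) :=
  mxvec (\matrix_(i < size Z) realization theta Z`_i).

(* 'J is the transpose of the usual Jacobian matrix (row vectors), which does
   not affect the rank.  Finite ordered sets are duplicate-free sequences. *)
Definition dim_fun (theta : P) : \bar R :=
  ereal_sup [set (\rank ('J (evaluation Z) theta))%:R%:E | Z in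
    [set Z : seq X | uniq Z /\ (forall z, z \in Z -> param_smooth theta z)]].

End Architecture.
End ReLUNetworks.

(* Main.v *)
(** The architecture is (1, 1, 1), with realization
    x |-> max(0, c max(0, a x + b) + d), and the function is the constant 1, realized
    by every parameter (a, b, 0, 1).  Near (0, -1, 0, 1) the hidden neuron is inactive
    on any given finite set, so the realization is the constant d there and the
    functional dimension is at most 1.  Near (1, 0, 0, 1) the realization at x > 0 is
    c (a x + b) + d, whose partial derivatives in c and d are x and 1, so two positive
    points already give rank 2. *)

From HB Require Import structures.
Require Import Defs.
From mathcomp Require Import all_boot all_order all_algebra.
From mathcomp Require Import all_classical all_reals all_analysis.
From mathcomp Require Import lra.

Import Order.TTheory GRing.Theory Num.Theory.
Import numFieldNormedType.Exports.

Local Open Scope classical_set_scope.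
Local Open Scope ring_scope.

(** * Differentials of functions that agree near a point *)

Section LocalDifferential.
Context {R : realType} {V W : normedModType R}.

(** The first-order expansion of [g] at [x] is also one of [f], and a differential is determined by
    its expansion. This lets a piecewise polynomial realization be replaced by the polynomial that
    it equals locally. *)
Lemma near_eq_is_diff (f g dg : V -> W) (x : V) :
  (\forall y \near x, f y = g y) -> is_diff x g dg -> is_diff x f dg.
Proof.
move=> fg [dgx <-]; have [dgc gE] := (diff_locallyP _ _).1 dgx.
have fE : f \o shift x = cst (f x) + 'd g x +o_ 0 id.
  apply/eqaddoP => e e0; move/eqaddoE/eqaddoP: gE => /(_ e e0).
  have : \forall h \near 0, f (h + x) = g (h + x).
    by move: fg; rewrite (near_shift 0 x) subr0; apply: filterS => y.
  apply: filterS2 => h /= fgh; congr (`| _ | <= _).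
  by rewrite !fctE/= fgh (nbhs_singleton fg).
have df : 'd f x = 'd g x :> (V -> W) by exact: diff_unique.
by apply: DiffDef => //; apply/diff_locallyP; rewrite df.
Qed.

End LocalDifferential.

(** * Polynomial functions and their smoothness *)

Section Polynomial.
Context {R : realType} {V : normedModType R}.

(** Polynomials are generated inductively, without coordinates, so that one notion serves both the
    parameter space and its product with the input space, and closure under differentiation is a
    structural induction. *)
Inductive polyfun : (V -> R) -> Prop :=
| polyfun_cst c : polyfun (fun=> c)
| polyfun_lin (l : {linear V -> R}) : continuous l -> polyfun l
| polyfunD f g : polyfun f -> polyfun g -> polyfun (fun x => f x + g x)
| polyfunM f g : polyfun f -> polyfun g -> polyfun (fun x => f x * g x).

Lemma polyfun_differentiable f x : polyfun f -> differentiable f x.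
Proof.
elim=> [c|l lc|{}f g _ fx _ gx|{}f g _ fx _ gx].
- exact: differentiable_cst.
- exact: linear_differentiable.
- exact: differentiableD.
- exact: differentiableM.
Qed.

Lemma polyfun_diff f v : polyfun f -> polyfun (fun x => 'd f x v).
Proof.
elim=> [c|l lc|{}f g pf ihf pg ihg|{}f g pf ihf pg ihg].
- rewrite (_ : (fun _ => _) = fun=> 0); first exact: polyfun_cst.
  by apply/funext => x; rewrite diff_cst.
- rewrite (_ : (fun _ => _) = fun=> l v); first exact: polyfun_cst.
  by apply/funext => x; rewrite diff_lin.
- rewrite (_ : (fun _ => _) = fun x => 'd f x v + 'd g x v).
    exact: polyfunD.
  by apply/funext => x; rewrite diffD //; exact: polyfun_differentiable.
- rewrite (_ : (fun _ => _) = fun x => f x * 'd g x v + g x * 'd f x v).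
    by apply: polyfunD; apply: polyfunM.
  by apply/funext => x; rewrite diffM //; exact: polyfun_differentiable.
Qed.

Lemma polyfun_continuous f : polyfun f -> continuous f.
Proof. by move=> pf x; apply/differentiable_continuous/polyfun_differentiable. Qed.

Lemma polyfun_open_gt0 f : polyfun f -> open [set x | 0 < f x].
Proof.
move=> pf; apply: (@open_comp _ _ f [set y | 0 < y]); last exact: open_gt.
by move=> x _; exact: polyfun_continuous.
Qed.

Lemma polyfun_open_lt0 f : polyfun f -> open [set x | f x < 0].
Proof.
move=> pf; apply: (@open_comp _ _ f [set y | y < 0]); last exact: open_lt.
by move=> x _; exact: polyfun_continuous.
Qed.

(** An entry of a continuous linear map is a continuous linear form. Below, [phi] is a projection of
    the product space or the identity of the parameter space. *)
Lemma polyfun_coord m n (phi : {linear V -> 'M[R]_(m, n)}) i j :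
  continuous phi -> polyfun (fun v => phi v i j).
Proof.
move=> phic.
have cl : linear (fun v => phi v i j : R) by move=> a u v; rewrite linearP !mxE.
pose clM := GRing.isLinear.Build _ _ _ _ _ cl.
pose cL : {linear V -> R} := HB.pack (fun v => phi v i j) clM.
have cLc : continuous cL.
  move=> v; apply: (@continuous_comp _ _ _ phi (fun M : 'M[R]_(m, n) => M i j)).
    exact: phic.
  exact: coord_continuous.
exact: (polyfun_lin cL cLc).
Qed.

(** Functions of the form [f x *: w] are stable under directional derivatives, which act on the
    scalar factor only; network outputs have this form with [w] the all-ones row. *)
Lemma Ck_on_polyfun (W : normedModType R) (w : W) f k U :
  polyfun f -> Ck_on k U (fun x => f x *: w).
Proof.
elim: k f => [|k ihk] f pf /=.
  move=> x _; apply/differentiable_continuous/differentiableZl.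
  exact: polyfun_differentiable.
split=> [x _|v]; first exact/differentiableZl/polyfun_differentiable.
rewrite (_ : (fun _ => _) = fun x => 'd f x v *: w).
  exact/ihk/polyfun_diff.
by apply/funext => x; rewrite diffZl //; exact: polyfun_differentiable.
Qed.

(** As [U] is open, equality on [U] is equality near each of its points, so the directional
    derivatives agree on [U] too and the induction on [k] continues. *)
Lemma eq_on_Ck_on (W : normedModType R) (U : set V) (f g : V -> W) k :
  open U -> (forall x, U x -> f x = g x) -> Ck_on k U g -> Ck_on k U f.
Proof.
move=> oU; elim: k f g => [|k ihk] f g fg /=.
  move=> gc x Ux; rewrite /prop_for /continuous_at (fg _ Ux).
  apply: cvg_trans (gc x Ux); apply: near_eq_cvg.
  by apply: filterS (open_nbhs_nbhs (conj oU Ux)) => y /fg.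
have fd x : U x -> differentiable g x -> is_diff x f ('d g x).
  move=> Ux gx; apply: (near_eq_is_diff _ g); last exact: differentiableP.
  by apply: filterS (open_nbhs_nbhs (conj oU Ux)) => y /fg.
move=> [gd gk]; split=> [x Ux|v]; first by have [] := fd x Ux (gd x Ux).
apply: ihk (gk v) => x Ux.
by have [_ ->] := fd x Ux (gd x Ux).
Qed.

Lemma smooth_at_eq_polyfun (W : normedModType R) (w : W) (U : set V)
    (f : V -> W) p x :
  open U -> U x -> polyfun p -> (forall y, U y -> f y = p y *: w) ->
  smooth_at f x.
Proof.
move=> oU Ux pp fp; exists U; split=> // k.
exact: (eq_on_Ck_on _ _ _ _ _ oU fp (Ck_on_polyfun _ _ _ _ _ pp)).
Qed.

End Polynomial.

(** * Bounding the rank and computing products of Jacobian matrices *)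

Section Jacobian.
Context {R : realType} {m n : nat}.
Implicit Types (f : 'rV[R]_m -> 'rV[R]_n) (x : 'rV[R]_m).

(** The Jacobian factors as the column of partial derivatives of [p] times the row [w]. *)
Lemma rank_jacobian_scale f (p : 'rV[R]_m -> R) (w : 'rV[R]_n) x :
  differentiable p x -> (\forall y \near x, f y = p y *: w) ->
  (\rank ('J f x) <= 1)%N.
Proof.
move=> px fp.
have [_ dfE] : is_diff x f (fun v => 'd p x v *: w).
  apply: (near_eq_is_diff _ (fun y => p y *: w)) => //.
  by apply: DiffDef; [exact: differentiableZl | rewrite diffZl].
have -> : 'J f x = (\col_i 'd p x (delta_mx 0 i)) *m w.
  apply/row_matrixP => i.
  rewrite row_mul rowE /jacobian mul_rV_lin1 dfE.
  by apply/rowP => j; rewrite !mxE big_ord1 !mxE.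
exact: leq_trans (mxrankM_maxr _ _) (rank_leq_row _).
Qed.

(** For small nonzero [h] the difference quotient along [v] is exactly [w], hence so is its
    limit. *)
Lemma jacobian_affine f x v w :
  differentiable f x ->
  (\forall h \near (0 : R), f (h *: v + x) = h *: w + f x) ->
  v *m 'J f x = w.
Proof.
move=> fx fE; rewrite -deriveEjacobian // /derive.
apply: cvg_lim => //; apply: (@cvg_trans _ (cst w @ (0 : R)^')); last exact: cvg_cst.
apply: near_eq_cvg.
apply: filterS2 (nbhs_dnbhs_neq (0 : R)) (nbhs_dnbhs fE) => h h0 /= ->.
by rewrite addrK scalerK.
Qed.

End Jacobian.

(** * Networks of architecture (1, 1, 1) *)

Section Network.
Context {R : realType}.
Local Notation P := 'rV[R]_(nparams 1 [:: 1; 1]%N).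

Definition layer1 (q : P) : 'M[R]_(1, 1 + 1) :=
  vec_mx (@lsubmx R 1 (1 * (1 + 1)) (nparams 1 [:: 1]%N) q).

Definition layer2 (q : P) : 'M[R]_(1, 1 + 1) :=
  vec_mx (@lsubmx R 1 (1 * (1 + 1)) (nparams 1 [::])
    (@rsubmx R 1 (1 * (1 + 1)) (nparams 1 [:: 1]%N) q)).

(** The last block has width 0: it is the empty parameter vector on which the recursion of
    [realization] ends. *)
Definition network (A B : 'M[R]_(1, 1 + 1)) : P :=
  row_mx (mxvec A) (row_mx (mxvec B) (0 : 'rV_(nparams 1 [::]))).

Definition weight (A : 'M[R]_(1, 1 + 1)) := A 0 (lshift 1 0).
Definition bias (A : 'M[R]_(1, 1 + 1)) := A 0 (rshift 1 0).
Definition layer (a b : R) : 'M[R]_(1, 1 + 1) := row_mx a%:M b%:M.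

Lemma layer1_network A B : layer1 (network A B) = A.
Proof. by rewrite /layer1 /network row_mxKl mxvecK. Qed.

Lemma layer2_network A B : layer2 (network A B) = B.
Proof. by rewrite /layer2 /network row_mxKr row_mxKl mxvecK. Qed.

Lemma weight_layer a b : weight (layer a b) = a.
Proof. by rewrite /weight /layer row_mxEl mxE. Qed.

Lemma bias_layer a b : bias (layer a b) = b.
Proof. by rewrite /bias /layer row_mxEr mxE. Qed.

Lemma layerD h a b c d :
  h *: layer a b + layer c d = layer (h * a + c) (h * b + d).
Proof. by rewrite /layer scale_row_mx add_row_mx !scale_scalar_mx -!raddfD. Qed.

Lemma affine_map_const (A : 'M[R]_(1, 1 + 1)) (x : 'rV_1) :
  affine_map A x = const_mx (weight A * x 0 0 + bias A).
Proof.
apply/rowP => j; rewrite /affine_map !mxE (ord1 j) big_split_ord /= !big_ord1.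
by rewrite ![_^T _ _]mxE row_mxEl row_mxEr mxE mulr1 /weight /bias.
Qed.

Lemma relu_const n (t : R) :
  relu (const_mx t : 'rV[R]_n) = const_mx (Num.max 0 t).
Proof. by apply/rowP => j; rewrite !mxE. Qed.

Lemma realizationE (q : P) (x : 'rV[R]_1) :
  realization q x = const_mx (Num.max 0 (weight (layer2 q) *
     Num.max 0 (weight (layer1 q) * x 0 0 + bias (layer1 q)) + bias (layer2 q))).
Proof.
rewrite [LHS]/= -[vec_mx (lsubmx q)]/(layer1 q).
rewrite -[vec_mx (lsubmx (rsubmx q))]/(layer2 q).
by rewrite !(affine_map_const, relu_const) !mxE.
Qed.

Definition preact (q : P) (t : R) : R :=
  weight (layer1 q) * t + bias (layer1 q).

Definition active_output (q : P) (t : R) : R :=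
  weight (layer2 q) * preact q t + bias (layer2 q).

Lemma realization_active (q : P) (x : 'rV[R]_1) :
  0 < preact q (x 0 0) -> 0 < active_output q (x 0 0) ->
  realization q x = active_output q (x 0 0) *: const_mx 1.
Proof.
move=> h1 h2; rewrite realizationE -/(preact _ _).
rewrite (max_idPr (ltW h1)) (max_idPr (ltW h2)).
by apply/rowP => j; rewrite !mxE mulr1.
Qed.

Lemma realization_inactive (q : P) (x : 'rV[R]_1) :
  preact q (x 0 0) < 0 -> 0 < bias (layer2 q) ->
  realization q x = bias (layer2 q) *: const_mx 1.
Proof.
move=> h1 h2; rewrite realizationE -/(preact _ _) (max_idPl (ltW h1)).
rewrite mulr0 add0r (max_idPr _) ?ltW//.
by apply/rowP => j; rewrite !mxE mulr1.
Qed.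

Section Parametrized.
Context {V : normedModType R} {phi : {linear V -> P}} {t : V -> R}.
Hypotheses (phic : continuous phi) (pt : polyfun t).

Lemma polyfun_layer1 i j : polyfun (fun v => layer1 (phi v) i j).
Proof.
rewrite (_ : (fun _ => _) = fun v => phi v 0 (lshift _ (mxvec_index i j))).
  exact: polyfun_coord.
by apply/funext => v; rewrite /layer1 !mxE.
Qed.

Lemma polyfun_layer2 i j : polyfun (fun v => layer2 (phi v) i j).
Proof.
rewrite (_ : (fun _ => _) =
    fun v => phi v 0 (rshift _ (lshift _ (mxvec_index i j)))).
  exact: polyfun_coord.
by apply/funext => v; rewrite /layer2 !mxE.
Qed.

Lemma polyfun_preact : polyfun (fun v => preact (phi v) (t v)).
Proof.
apply: polyfunD; last exact: polyfun_layer1.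
by apply: polyfunM => //; exact: polyfun_layer1.
Qed.

Lemma polyfun_active_output : polyfun (fun v => active_output (phi v) (t v)).
Proof.
apply: polyfunD; last exact: polyfun_layer2.
by apply: polyfunM; [exact: polyfun_layer2|exact: polyfun_preact].
Qed.

End Parametrized.

Lemma layer1_linear (h : R) (u v : P) :
  layer1 (h *: u + v) = h *: layer1 u + layer1 v.
Proof. by apply/matrixP => i j; rewrite !mxE. Qed.

Lemma layer2_linear (h : R) (u v : P) :
  layer2 (h *: u + v) = h *: layer2 u + layer2 v.
Proof. by apply/matrixP => i j; rewrite !mxE. Qed.

(** * Smooth points and evaluation maps of these networks *)

Local Notation X := 'rV[R]_1.

Let polyfun_input : polyfun (fun y : P * X => y.2 0 0).
Proof.
have sc : continuous (snd : P * X -> X) by move=> y; exact: cvg_snd.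
exact: (@polyfun_coord R (P * X)%type 1 1 snd 0 0 sc).
Qed.

Let fst_continuous : continuous (fst : P * X -> P).
Proof. by move=> y; exact: cvg_fst. Qed.

Lemma param_smooth_active (q : P) (x : X) :
  0 < preact q (x 0 0) -> 0 < active_output q (x 0 0) -> param_smooth q x.
Proof.
move=> h1 h2.
have pp := polyfun_preact fst_continuous polyfun_input.
have pa := polyfun_active_output fst_continuous polyfun_input.
apply: (smooth_at_eq_polyfun _ (const_mx 1) _ _ _ (q, x)
  (openI (polyfun_open_gt0 _ pp) (polyfun_open_gt0 _ pa)) _ pa) => //.
by move=> y [y1 y2]; exact: realization_active.
Qed.

Lemma param_smooth_inactive (q : P) (x : X) :
  preact q (x 0 0) < 0 -> 0 < bias (layer2 q) -> param_smooth q x.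
Proof.
move=> h1 h2.
have pp := polyfun_preact fst_continuous polyfun_input.
have pb := polyfun_layer2 fst_continuous 0 (rshift 1 0).
apply: (smooth_at_eq_polyfun _ (const_mx 1) _ _ _ (q, x)
  (openI (polyfun_open_lt0 _ pp) (polyfun_open_gt0 _ pb)) _ pb) => //.
by move=> y [y1 y2]; exact: realization_inactive.
Qed.

Let idP_continuous : continuous (idfun : P -> P).
Proof. by move=> y. Qed.

Lemma evaluationE (Z : seq X) (q : P) i k :
  evaluation Z q 0 (mxvec_index i k) = realization q Z`_i 0 k.
Proof. by rewrite /evaluation mxvecE mxE. Qed.

Lemma evaluation_scale (Z : seq X) (q : P) (c : R) :
  (forall i : 'I_(size Z), realization q Z`_i = c *: const_mx 1) ->
  evaluation Z q = c *: const_mx 1.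
Proof.
move=> Zc; apply/rowP => j; case/mxvec_indexP: j => i k.
by rewrite evaluationE Zc !mxE.
Qed.

(** Since [Z] is finite, a single neighborhood of [q] keeps the hidden neuron inactive at all its
    points; there the evaluation is the output bias times a fixed row. *)
Lemma rank_evaluation_inactive (Z : seq X) (q : P) :
  (forall t, preact q t < 0) -> 0 < bias (layer2 q) ->
  (\rank ('J (evaluation Z) q) <= 1)%N.
Proof.
move=> h1 h2.
have pb := @polyfun_layer2 P idfun idP_continuous 0 (rshift 1 0).
apply: (rank_jacobian_scale _ (fun q => bias (layer2 q)) (const_mx 1)).
  exact: polyfun_differentiable.
have nb := open_nbhs_nbhs (conj (polyfun_open_gt0 _ pb) h2).
have npre (i : 'I_(size Z)) : \forall u \near q, preact u (Z`_i 0 0) < 0.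
  have pp := @polyfun_preact P idfun _ idP_continuous (polyfun_cst (Z`_i 0 0)).
  exact: open_nbhs_nbhs (conj (polyfun_open_lt0 _ pp) (h1 _)).
apply: filterS2 nb (filter_forall _ npre) => u u2 u1.
by apply: evaluation_scale => i; exact: realization_inactive.
Qed.

Lemma differentiable_evaluation_active (Z : seq X) (q : P) :
  (forall i : 'I_(size Z), 0 < preact q (Z`_i 0 0) /\
                           0 < active_output q (Z`_i 0 0)) ->
  differentiable (evaluation Z) q.
Proof.
move=> Zq.
have pp (i : 'I_(size Z)) := @polyfun_preact P idfun _ idP_continuous
  (polyfun_cst (Z`_i 0 0)).
have pa (i : 'I_(size Z)) := @polyfun_active_output P idfun _ idP_continuous
  (polyfun_cst (Z`_i 0 0)).
(* [w i] is the indicator of the block of coordinates of the [i]-th point, so near [q] the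
   evaluation is a sum of polynomials times fixed rows. *)
pose w (i : 'I_(size Z)) : 'rV[R]_(size Z * last 1%N [:: 1; 1]%N) :=
  mxvec (\matrix_(k, j) (k == i)%:R).
pose g := \sum_(i < size Z) (fun u : P => active_output u (Z`_i 0 0) *: w i).
have gd : differentiable g q.
  apply: differentiable_sum => i.
  exact/differentiableZl/polyfun_differentiable/pa.
suff: is_diff q (evaluation Z) ('d g q) by case.
apply: (near_eq_is_diff _ g); last exact: differentiableP.
have n1 (i : 'I_(size Z)) : \forall u \near q,
    0 < preact u (Z`_i 0 0) /\ 0 < active_output u (Z`_i 0 0).
  apply: open_nbhs_nbhs; split; last exact: Zq.
  exact: openI (polyfun_open_gt0 _ (pp i)) (polyfun_open_gt0 _ (pa i)).
apply: filterS (filter_forall _ n1) => u u1.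
apply/rowP => j; case/mxvec_indexP: j => i k.
rewrite evaluationE realization_active ?(u1 i).1 ?(u1 i).2//.
rewrite /g fct_sumE summxE (bigD1 i)//= big1 => [|l li].
  by rewrite addr0 [RHS]mxE /w mxvecE !mxE eqxx.
by rewrite mxE /w mxvecE !mxE eq_sym (negbTE li) mulr0.
Qed.

End Network.

(** * Two parameters in the fiber of the constant 1 *)

Theorem proposition11p7 (R : realType) :
  exists (n0 : nat) (ns : seq nat),
    is_architecture n0 ns /\
    exists f : 'rV[R]_n0 -> 'rV[R]_(last n0 ns),
      moduli_space f /\
      exists theta1 theta2 : 'rV[R]_(nparams n0 ns),
        [/\ fiber f theta1, fiber f theta2,
            ordinary theta1, ordinary theta2 &
            dim_fun theta1 <> dim_fun theta2].
Proof.
pose theta1 : 'rV[R]_(nparams 1 [:: 1; 1]%N) :=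
  network (layer 0 (-1)) (layer 0 1).
pose theta2 : 'rV[R]_(nparams 1 [:: 1; 1]%N) :=
  network (layer 1 0) (layer 0 1).
have pre1 t : preact theta1 t < 0.
  by rewrite /preact layer1_network weight_layer bias_layer mul0r add0r ltrN10.
have b1 : 0 < bias (layer2 theta1) by rewrite layer2_network bias_layer.
have pre2 t : preact theta2 t = t.
  by rewrite /preact layer1_network weight_layer bias_layer mul1r addr0.
have act2 t : active_output theta2 t = 1.
  by rewrite /active_output layer2_network weight_layer bias_layer mul0r add0r.
pose f : 'rV[R]_1 -> 'rV[R]_(last 1 [:: 1; 1])%N := fun=> const_mx 1.
have f1 : fiber f theta1.
  apply/funext => x; rewrite realizationE layer2_network weight_layer bias_layer.
  by rewrite mul0r add0r (max_idPr _).
have f2 : fiber f theta2.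
  apply/funext => x; rewrite realizationE layer2_network weight_layer bias_layer.
  by rewrite mul0r add0r (max_idPr _).
have smooth2 (t : R) : 0 < t -> param_smooth theta2 (const_mx t : 'rV_1).
  by move=> t0; apply: param_smooth_active; rewrite ?pre2 ?act2 // mxE.
have o1 : ordinary theta1 by exists 0; exact: param_smooth_inactive.
have o2 : ordinary theta2 by exists (const_mx 1); apply: smooth2.
exists 1%N, [:: 1; 1]%N; split; first by [].
exists f; split; first exact: (ex_intro2 _ _ theta1 I f1).
exists theta1, theta2; split; [exact: f1|exact: f2|exact: o1|exact: o2|].
have dim1 : (dim_fun theta1 <= (1 : R)%:E)%E.
  apply: ge_ereal_sup => _ [Z _ <-]; rewrite lee_fin lern1.
  exact: rank_evaluation_inactive.
have dim2 : ((2 : R)%:E <= dim_fun theta2)%E.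
  pose Z : seq 'rV[R]_1 := [:: const_mx 1; const_mx 2].
  have ZE (k : 'I_2) : (Z`_k) 0 0 = k.+1%:R by case: k => -[|[]]//= i; rewrite mxE.
  have Z0 (k : 'I_2) : 0 < (Z`_k) 0 0 by rewrite ZE.
  apply: (@le_trans _ _ (\rank ('J (evaluation Z) theta2))%:R%:E); last first.
    apply: ereal_sup_ubound; exists Z => //; split.
      rewrite /= andbT inE; apply/eqP => /matrixP/(_ 0 0).
      by rewrite !mxE; lra.
    by move=> z; rewrite !inE => /orP[] /eqP ->; exact: smooth2.
  rewrite lee_fin ler_nat.
  set J := 'J _ _.
  have dE : differentiable (evaluation Z) theta2.
    by apply: differentiable_evaluation_active => i; rewrite pre2 act2; split.
  (* The line through theta2 with direction [v i] moves the value at the k-th point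
     of [Z] at speed [k == i]. *)
  pose v (i : 'I_2) : 'rV[R]_(nparams 1 [:: 1; 1]%N) :=
    network 0 (layer (2 * i%:R - 1) (2 - 3 * i%:R)).
  have vJ i : v i *m J = mxvec (delta_mx i 0).
    apply: jacobian_affine => //; near=> h.
    apply/rowP => j; case/mxvec_indexP: j => k l.
    rewrite [RHS]mxE [X in _ = X + _]mxE !evaluationE mxvecE.
    have -> : realization theta2 Z`_k = const_mx 1 by rewrite -[RHS]/(f Z`_k) -f2.
    rewrite realizationE layer1_linear layer2_linear !layer1_network.
    rewrite !layer2_network scaler0 add0r weight_layer bias_layer mul1r addr0.
    rewrite (max_idPr (ltW (Z0 k))) ZE [delta_mx _ _ _ _]mxE ![const_mx _ _ _]mxE.
    rewrite (ord1 l) eqxx andbT layerD weight_layer bias_layer.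
    (* The points of [Z] are 1 and 2, and the affine functions [2 - x] and [x - 1] encoded by [v 0]
       and [v 1] are the Lagrange basis at these nodes. For [h > -1] the output neuron stays
       active. *)
    rewrite [X in Num.max 0 X](_ : _ = h * (k == i)%:R + 1).
      apply/max_idPr; have : -1 < h by near: h; apply: lt_nbhsr; exact: ltrN10.
      by case: (k == i); rewrite /= ?(mulr1n, mulr0n); lra.
    case: k i {ZE Z0} => -[|[|//]] ki [[|[|//]] ii];
      by rewrite -val_eqE /= ?(mulr1n, mulr0n); lra.
  (* [N] merely reshapes a flattened 2 by 1 column into a row of length 2. The identity of rank 2
     then factors through [J], which bounds the rank of [J] from below. *)
  pose N : 'M[R]_(2 * 1, 2) := lin1_mx (trmx \o vec_mx).
  have VJN : (\matrix_i v i) *m J *m N = 1%:M.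
    apply/row_matrixP => i; rewrite !row_mul rowK vJ mul_rV_lin1 /= mxvecK.
    by rewrite trmx_delta rowE mulmx1.
  rewrite -(mxrank1 R 2) -VJN.
  exact: leq_trans (mxrankM_maxl _ _) (mxrankM_maxr _ _).
move=> d12; have := le_trans dim2 (le_trans _ dim1).
by rewrite d12 lexx lee_fin => /(_ isT); lra.
Unshelve. all: by end_near.
Qed.
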